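(* Assume that for every $i$ the faces $F_{ij}$ and $F_{ij'}$ do not share vertices when $j\ne j'$. For $S\subseteq\{1,\dots,n_p\}$ with $|S|=k$ and $s\in J^S=\prod_{i\in S}\{1,\dots,j_i\}$, let $\eta^{S,s}(x)$ be the barycentric indicator associated with $F^{S,s}$. Then substituting $\eta^{S,s}(x)$ for $\gamma^{S,s}$ in the system $(\mathrm{FDR}^k)$ given in the context gives a nonlinear relaxation of $\mathrm{FD}$. For $r\in\prod_{i\in S}\{1,\dots,p_i\}$ let $\chi_S(i,r,x)=V_{ir_i}$ if $i\in S$ and $\chi_S(i,r,x)=x_i$ otherwise. Then, for all $S\subseteq\{1,\dots,n_p\}$ with $|S|=k$ and $s\in J^S$, and $x$ with $x_i\in\bigcup_jF_{ij}$ for all $i$, $$\eta^{S,s}(x)\begin{bmatrix}1 \\ x\end{bmatrix}=\sum_{r\in\prod_{i\in S}E_i(s_i)}\Bigl(\prod_{i\in S}\lambda_{ir_i}(x_i)\Bigr)\begin{bmatrix}1\\ \chi_S(1,r,x)\\ \vdots\\ \chi_S(n_p,r,x)\end{bmatrix}.$$ In particular, for such $x$ and a given $r\in\prod_{i\in S}\{1,\dots,p_i\}$, $$\eta^{S,s}(x)\prod_{i\in S}\lambda_{ir_i}(x_i)=\begin{cases}\prod_{i\in S}\lambda_{ir_i}(x_i)&\text{if } r_i\in E_i(s_i)\text{ for all } i\in S,\\0&\text{otherwise.}\end{cases}$$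
   Context: Facial disjunctive set: $\mathrm{FD}=\{(x,y)\mid Bx+Dy\le_{\bar K}c,\ x_i\in\bigcup_{j=1}^{j_i}F_{ij},\ i=1,\dots,n_p\}$, where $x=(x_1;\dots;x_{n_p})$, $x_i\in\mathbb R^{n_i}$, $n=\sum_i n_i$, $y\in\mathbb R^{n_y}$, $F_{i1},\dots,F_{ij_i}$ are disjoint faces of a polytope $P_i\subset\mathbb R^{n_i}$, $\bar K\subseteq\mathbb R^{m_k}$ is a convex cone, $a\le_{\bar K}a'$ means $a'-a\in\bar K$, $B\in\mathbb R^{m_k\times n}$, $D\in\mathbb R^{m_k\times n_y}$, $c\in\mathbb R^{m_k}$. For $s=(s_i)_{i\in S}$, $F^{S,s}=\{x\mid x_i\in F_{is_i}\ (i\in S),\ x_i\in\bigcup_jF_{ij}\ (i\notin S)\}$. $P_i$ has vertices $V_{i1},\dots,V_{ip_i}$, and $\lambda_{i1},\dots,\lambda_{ip_i}$ are barycentric coordinates on $P_i$: functions with $\lambda_{ir}(x_i)\ge0$, $\sum_r\lambda_{ir}(x_i)=1$, $\sum_r\lambda_{ir}(x_i)V_{ir}=x_i$ for $x_i\in P_i$. $E_i(j)=\{r\mid V_{ir}\in F_{ij}\}$. The barycentric indicator of $F_{ij}$ is $\eta_{ij}(x_i)=\sum_{r_i\in E_i(j)}\lambda_{ir_i}(x_i)$, and the barycentric indicator associated with $F^{S,s}$ is $\eta^{S,s}(x)=\prod_{i\in S}\eta_{is_i}(x_i)$. System $(\mathrm{FDR}^k)$: let $(\tau^{ij},\pi^{ij})\in\mathbb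 R^{n_i+1}$ be such that $\tau^{ij}-(\pi^{ij})^\top x_i\ge0$ is valid for $P_i$ and $F_{ij}=\{x_i\in P_i\mid\tau^{ij}-(\pi^{ij})^\top x_i\le0\}$. The system requires, for all $S\subseteq\{1,\dots,n_p\}$ with $|S|=k$ and all $s\in J^S$: $\gamma^{S,s}(-c+Bx+Dy)\le_{\bar K}0$; $\sum_{s\in J^S}\gamma^{S,s}(1;x;y)=(1;x;y)$; $\gamma^{S,s}x_{i'}\in\gamma^{S,s}P_{i'}$ for all $i'\in\{1,\dots,n_p\}$; $\gamma^{S,s}(\tau^{is_i}-(\pi^{is_i})^\top x_i)\le0$ for all $i\in S$; $\gamma^{S,s}\ge0$. A nonlinear relaxation of $\mathrm{FD}$ is a system satisfied by every point $(x,y)\in\mathrm{FD}$. *)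

(* Defs.v *)
From HB Require Import structures.
From mathcomp Require Import all_boot all_order all_algebra.
(* After all_boot, so that set0, setT, trivIset, ... refer to classical sets. *)
From mathcomp Require Import boolp classical_sets reals convex.

Set Implicit Arguments.
Unset Strict Implicit.
Unset Printing Implicit Defensive.

Import Order.TTheory GRing.Theory Num.Theory.

Local Open Scope classical_set_scope.
Local Open Scope ring_scope.

Section Polytopes.
Context {R : realType} {n : nat}.
Implicit Types (P F : set 'cV[R]_n) (x v : 'cV[R]_n).

Definition dot v x : R := (v^T *m x) 0 0.

Definition polytope P := exists (q : nat) (W : 'I_q -> 'cV[R]_n),
  P = [set x | exists a : 'I_q -> R,
    [/\ forall r, 0 <= a r, \sum_r a r = 1 & \sum_r a r *: W r = x]].

(* The inequality t - <v, x> >= 0 is valid for P and is tight exactly on F. *)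
Definition supports P F (t : R) (v : 'cV[R]_n) :=
  (forall x, P x -> 0 <= t - dot v x) /\
  F = [set x | P x /\ t - dot v x <= 0].

Definition face P F := exists t v, supports P F t v.

Definition vertex P v := face P [set v].

Definition vertices_of P (p : nat) (V : 'I_p -> 'cV[R]_n) :=
  injective V /\ forall v, vertex P v <-> exists r, V r = v.

(* The coordinate functions are total; they are constrained on P only. *)
Definition barycentric P (p : nat) (V : 'I_p -> 'cV[R]_n)
    (lambda : 'I_p -> 'cV[R]_n -> R) :=
  forall x, P x ->
    [/\ forall r, 0 <= lambda r x,
        \sum_r lambda r x = 1 &
        \sum_r lambda r x *: V r = x].

Definition vertex_idx (p : nat) (V : 'I_p -> 'cV[R]_n) F : {set 'I_p} :=
  [set r | V r \in F]%SET.

Definition face_indicator (p : nat) (V : 'I_p -> 'cV[R]_n)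
    (lambda : 'I_p -> 'cV[R]_n -> R) F x : R :=
  \sum_(r in vertex_idx V F) lambda r x.

(* Nonnegative multiples: a nonempty cone contains 0. *)
Definition convex_cone (K : set 'cV[R]_n) :=
  convex_set K /\ forall (a : R) v, 0 <= a -> K v -> K (a *: v).

Definition le_cone (K : set 'cV[R]_n) (a a' : 'cV[R]_n) := K (a' - a).

End Polytopes.

(* Elements of the product of the {0, ..., a i - 1} over i in S. *)
Notation idx S a :=
  {dffun forall i : {i | i \in S}, 'I_(a (val i))} (only parsing).

Section FacialDisjunctive.
Context {R : realType} {N : nat} {d : 'I_N -> nat}.

(* The stacked vector x = (x_1; ...; x_N), with blocks x_i = submxcol x i. *)
Notation X := 'cV[R]_(\sum_i d i).

Section Indicator.
Context {p : 'I_N -> nat}.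
Variable V : forall i, 'I_(p i) -> 'cV[R]_(d i).
Variable lambda : forall i, 'I_(p i) -> 'cV[R]_(d i) -> R.
Context {J : 'I_N -> nat}.
Variable F : forall i, 'I_(J i) -> set 'cV[R]_(d i).
Arguments V : clear implicits.
Arguments lambda : clear implicits.
Arguments F : clear implicits.

Definition indicator (S : {set 'I_N}) (s : idx S J) (x : X) : R :=
  \prod_(i : {i | i \in S})
    face_indicator (V (val i)) (lambda (val i)) (F (val i) (s i))
                   (submxcol x (val i)).

Definition coord_prod (S : {set 'I_N}) (r : idx S p) (x : X) : R :=
  \prod_(i : {i | i \in S}) lambda (val i) (r i) (submxcol x (val i)).

Definition vertices_in (S : {set 'I_N}) (s : idx S J) (r : idx S p) : bool :=
  [forall i : {i | i \in S}, r i \in vertex_idx (V (val i)) (F (val i) (s i))].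

(* The match keeps the proof of i \in S needed to read off r at i. *)
Definition chi (S : {set 'I_N}) (i : 'I_N) (r : idx S p) (x : X) :
    'cV[R]_(d i) :=
  match @idP (i \in S) with
  | ReflectT iS => V i (r (exist _ i iS))
  | ReflectF _ => submxcol x i
  end.

End Indicator.

Section System.
Context {m ny : nat} {J : 'I_N -> nat}.
Variable P : forall i, set 'cV[R]_(d i).
Variable F : forall i, 'I_(J i) -> set 'cV[R]_(d i).
Variable K : set 'cV[R]_m.
Variables (B : 'M[R]_(m, \sum_i d i)) (D : 'M[R]_(m, ny)) (c : 'cV[R]_m).
Variable tau : forall i, 'I_(J i) -> R.
Variable ppi : forall i, 'I_(J i) -> 'cV[R]_(d i).
Arguments P : clear implicits.
Arguments F : clear implicits.
Arguments tau : clear implicits.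
Arguments ppi : clear implicits.

Definition in_faces (x : X) := forall i, (\bigcup_j F i j) (submxcol x i).

Definition FD : set (X * 'cV[R]_ny) :=
  [set z | le_cone K (B *m z.1 + D *m z.2) c /\ in_faces z.1].

(* gamma S s is a scalar: each product below is a genuine (nonlinear) product,
   and the system is read as a condition on (x, y) for a given family gamma. *)
Definition FDR (k : nat) (gamma : forall S : {set 'I_N}, idx S J -> R)
    (z : X * 'cV[R]_ny) :=
  let: (x, y) := z in
  forall S : {set 'I_N}, #|S| = k ->
  [/\ forall s, le_cone K (gamma S s *: (- c + B *m x + D *m y)) 0,
      \sum_s gamma S s *: col_mx (1%:M : 'M[R]_1) (col_mx x y)
        = col_mx 1%:M (col_mx x y),
      forall s i,
        [set gamma S s *: u | u in P i] (gamma S s *: submxcol x i),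
      forall s (i : {i | i \in S}),
        gamma S s * (tau (val i) (s i)
                     - dot (ppi (val i) (s i)) (submxcol x (val i))) <= 0 &
      forall s, 0 <= gamma S s].

End System.
End FacialDisjunctive.

Definition relaxation {T : Type} (A : set T) (system : T -> Prop) :=
  forall z, A z -> system z.

(* Main.v *)
Require Import Defs.
From HB Require Import structures.
From mathcomp Require Import all_boot all_order all_algebra.
From mathcomp Require Import boolp classical_sets reals convex.

Set Implicit Arguments.
Unset Strict Implicit.
Unset Printing Implicit Defensive.

Import Order.TTheory GRing.Theory Num.Theory.
Local Open Scope classical_set_scope.
Local Open Scope ring_scope.


(** Let x_i lie in the face F_ij of P_i.  The affine function that defines F_ij
    is nonnegative at the vertices of P_i, and its value at x_i, which is at
    most 0, is its average over the vertices with weights lambda_ir(x_i).  So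
    only vertices of F_ij get a nonzero weight ([barycentric_face0]).  Two
    distinct faces of the family are disjoint, so x determines j =: s0_i, and
    the indicator eta_ij(x_i) is 1 if j = s0_i and 0 otherwise
    ([face_indicatorE]).

    Consequently eta^{S,s}(x) is 1 if s is the restriction of s0 to S, and 0
    for every other s ([indicatorE]).  The system is then immediate: for the one
    s with a nonzero multiplier its constraints say that (x, y) is in FD and
    that x_i is in F_is_i, and the multipliers sum to 1.

    A nonzero product of coordinates only involves vertices of the faces
    F_i(s0_i), hence its index r lies in the product of the E_i(s_i) exactly
    when s agrees with s0 on S.  This gives the product formula
    ([indicator_coord_prod]).  The vector identity follows from it: multiply
    by eta^{S,s}(x) the identity that writes (1; x) as the sum over all r of the
    coordinate products times (1; chi_S(r, x)) ([sum_coord_prod_chi]).  The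
    latter is the statement that each coordinate of a product of probability
    weights has its own weights as marginal ([sum_dffun_prod_marginal]). *)

Section DependentProducts.
Context {R : comPzRingType} {I : finType} {T : I -> finType}.
Implicit Type f : forall i, T i -> R.

Lemma sum_dffun_prod f :
  \sum_(r : {dffun forall i, T i}) \prod_i f i (r i) = \prod_i \sum_q f i q.
Proof.
rewrite (reindex (@dffun_of_fprod _ T)); last exact/onW_bij/dffun_of_fprod_bij.
transitivity (\sum_(t : fprod T) \prod_(i in I) finfun (f i) (t i)).
  by apply: eq_bigr => t _; apply: eq_bigr => i _; rewrite !ffunE.
rewrite big_fprod.
rewrite -(bigA_distr_big_dep (tagged_with T) (fun i => untag 0 (finfun (f i)))).
apply: eq_bigr => i _; rewrite -(big_tag (fun i => finfun (f i)) i).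
by apply: eq_bigr => q _; rewrite ffunE.
Qed.

(** Under a product of normalized weights, each coordinate keeps its own
    weights as marginal. *)
Lemma sum_dffun_prod_marginal (U : lmodType R) f i0 (g : T i0 -> U) :
    (forall i, \sum_q f i q = 1) ->
  \sum_(r : {dffun forall i, T i}) (\prod_i f i (r i)) *: g (r i0)
    = \sum_q f i0 q *: g q.
Proof.
move=> f1.
have marginal q :
    \sum_(r : {dffun forall i, T i} | r i0 == q) \prod_i f i (r i) = f i0 q.
  (* Keeping only the weight of q at i0 encodes the condition r i0 = q. *)
  pose fq := dfwith f (fun q' => if q' == q then f i0 q' else 0).
  transitivity (\prod_i \sum_q' fq i q').
    rewrite -sum_dffun_prod big_mkcond; apply: eq_bigr => r _.
    rewrite (bigD1 i0) //= [in RHS](bigD1 i0) //= /fq dfwith_in.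
    under [in RHS]eq_bigr => i ii0 do rewrite dfwith_out 1?eq_sym //.
    by case: ifP; rewrite ?mul0r.
  rewrite (bigD1 i0) //= [X in _ * X]big1 => [|i ii0]; last first.
    by rewrite /fq dfwith_out 1?eq_sym.
  by rewrite mulr1 /fq dfwith_in -big_mkcond big_pred1_eq.
rewrite (partition_big (fun r : {dffun forall i, T i} => r i0) predT) //=.
apply: eq_bigr => q _; rewrite -marginal scaler_suml.
by apply: eq_bigr => r /eqP ->.
Qed.

End DependentProducts.

Section FaceCoordinates.
Context {R : realType} {n p : nat} {P : set 'cV[R]_n}.
Context {V : 'I_p -> 'cV[R]_n} {lambda : 'I_p -> 'cV[R]_n -> R}.
Implicit Types (F : set 'cV[R]_n) (x : 'cV[R]_n).

Lemma face_sub F : face P F -> F `<=` P.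
Proof. by move=> [t [v [_ ->]]] x []. Qed.

Lemma dot_sum (v : 'cV[R]_n) (a : 'I_p -> R) :
  dot v (\sum_r a r *: V r) = \sum_r a r * dot v (V r).
Proof.
by rewrite /dot mulmx_sumr summxE; under eq_bigr do rewrite -scalemxAr mxE.
Qed.

(** A point of a face puts no weight on the vertices outside that face. *)
Lemma barycentric_face0 F x r : barycentric P V lambda ->
  (forall q, P (V q)) -> face P F -> F x -> ~ F (V r) -> lambda r x = 0.
Proof.
move=> bary PV fF Fx nFr; have [l0 l1 lx] := bary x (face_sub fF Fx).
have [t [v [valid FE]]] := fF; apply/eqP; apply: contra_notT nFr => lr.
(* The affine function t - <v, .> commutes with the barycentric average. *)
have slack : \sum_q lambda q x * (t - dot v (V q)) = t - dot v x.
  rewrite -[in RHS]lx dot_sum -[t in RHS]mul1r -l1 mulr_suml -sumrB.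
  by apply: eq_bigr => q _; rewrite mulrBr.
have Fx' := Fx; rewrite FE in Fx'; case: Fx' => _; rewrite -slack => le0.
rewrite FE; split=> //.
(* A nonpositive sum of nonnegative terms: every term vanishes. *)
have ge0 q : 0 <= lambda q x * (t - dot v (V q)).
  by apply: mulr_ge0 => //; apply: valid.
have /eqP : \sum_q lambda q x * (t - dot v (V q)) = 0.
  by apply/eqP; rewrite eq_le le0 sumr_ge0.
rewrite psumr_eq0 // => /allP /(_ r (mem_index_enum r)) /=.
by rewrite mulf_eq0 (negbTE lr) => /eqP ->.
Qed.

End FaceCoordinates.

Section ProductIndicator.
Context {R : realType} {N : nat} {d J p : 'I_N -> nat}.
Context {P : forall i, set 'cV[R]_(d i)}.
Context {F : forall i, 'I_(J i) -> set 'cV[R]_(d i)}.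
Context {V : forall i, 'I_(p i) -> 'cV[R]_(d i)}.
Context {lambda : forall i, 'I_(p i) -> 'cV[R]_(d i) -> R}.
Arguments P : clear implicits.
Arguments F : clear implicits.
Arguments V : clear implicits.
Arguments lambda : clear implicits.
Context (bary : forall i, barycentric (P i) (V i) (lambda i)).
Context {S : {set 'I_N}} {x : 'cV[R]_(\sum_i d i)}.

(** The coordinate products over S are probability weights under which the
    mean of the vertex V_ir_i is x_i for i in S; the other blocks are constant. *)
Lemma sum_coord_prod_chi : (forall i, P i (submxcol x i)) ->
  \sum_(r : idx S p) coord_prod lambda r x
      *: col_mx (1%:M : 'M[R]_1) (\mxcol_i chi V i r x)
    = col_mx 1%:M x.
Proof.
move=> Px; pose l (i : {i | i \in S}) q := lambda (val i) q (submxcol x (val i)).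
have l1 i : \sum_q l i q = 1 by have [] := bary (Px (val i)).
have coord1 : \sum_(r : idx S p) coord_prod lambda r x = 1.
  by rewrite (sum_dffun_prod l) big1.
under [LHS]eq_bigr do rewrite scale_col_mx.
rewrite -[LHS]vsubmxK !linear_sum /=; congr col_mx.
  by under [LHS]eq_bigr do rewrite col_mxKu; rewrite -scaler_suml coord1 scale1r.
under [LHS]eq_bigr do rewrite col_mxKd.
apply/mxcolP => i; rewrite submxcol_sum.
have submxcolZ (a : R) (A : 'cV[R]_(\sum_i d i)) :
    submxcol (a *: A) i = a *: submxcol A i.
  by apply/matrixP => ? ?; rewrite !mxE.
under [LHS]eq_bigr do rewrite submxcolZ mxcolK /chi.
case: {-}_ / idP => iS; last by rewrite -scaler_suml coord1 scale1r.
rewrite (sum_dffun_prod_marginal (i0 := exist _ i iS) (V i) l1).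
by have [] := bary (Px i).
Qed.

Context (PV : forall i q, P i (V i q)) (faceF : forall i j, face (P i) (F i j)).
Context (disjF : forall i, trivIset setT (F i)).
(* s0 i is the index of the face that contains the block x_i. *)
Context (s0 : forall i, 'I_(J i)).
Context (Fx : forall i, F i (s0 i) (submxcol x i)).

Lemma mem_vertex_idx i j q : lambda i q (submxcol x i) != 0 ->
  (q \in vertex_idx (V i) (F i j)) = (j == s0 i).
Proof.
move=> lq; have Fq : F i (s0 i) (V i q).
  apply: contrapT => nF; move/eqP: lq; apply.
  exact: barycentric_face0 (@bary i) (@PV i) (@faceF i (s0 i)) (@Fx i) nF.
rewrite inE; apply/idP/eqP => [|->]; last exact/mem_set.
by move=> /set_mem Fjq; apply: (@disjF i) => //; exists (V i q).
Qed.

Lemma face_indicatorE i j :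
  face_indicator (V i) (lambda i) (F i j) (submxcol x i) = (j == s0 i)%:R.
Proof.
have [_ l1 _] := @bary i _ (face_sub (@faceF i (s0 i)) (@Fx i)).
transitivity (\sum_q (j == s0 i)%:R * lambda i q (submxcol x i)); last first.
  by rewrite -mulr_sumr l1 mulr1.
rewrite /face_indicator big_mkcond; apply: eq_bigr => q _.
have [->|lq] := eqVneq (lambda i q (submxcol x i)) 0; first by rewrite mulr0 if_same.
by rewrite mem_vertex_idx //; case: eqP; rewrite ?mul1r ?mul0r.
Qed.

(** On the disjunctive set the indicator takes the values 0 and 1, and detects
    whether s lists the faces containing the blocks of x. *)
Lemma indicatorE (s : idx S J) :
  indicator V lambda F s x = [forall i, s i == s0 (val i)]%:R.
Proof.
rewrite /indicator; under eq_bigr do rewrite face_indicatorE.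
have [/forallP h|/forallPn[i ne]] := boolP [forall i, s i == s0 (val i)].
  by rewrite big1 // => i _; rewrite h.
by rewrite (bigD1 i) //= (negbTE ne) mul0r.
Qed.

(** Membership of r in the product of the E_i(s_i) only depends on s, as long as
    r has a nonzero weight. *)
Lemma vertices_inE (s : idx S J) (r : idx S p) : coord_prod lambda r x != 0 ->
  vertices_in V F s r = [forall i, s i == s0 (val i)].
Proof.
move=> cr; rewrite /vertices_in; apply: eq_forallb => i; rewrite mem_vertex_idx //.
by apply: contraNneq cr => l0; rewrite /coord_prod (bigD1 i) //= l0 mul0r.
Qed.

Lemma indicator_coord_prod (s : idx S J) (r : idx S p) :
  indicator V lambda F s x * coord_prod lambda r x
    = if vertices_in V F s r then coord_prod lambda r x else 0.
Proof.
have [->|cr] := eqVneq (coord_prod lambda r x) 0; first by rewrite mulr0 if_same.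
by rewrite indicatorE vertices_inE //; case: ifP; rewrite ?mul1r ?mul0r.
Qed.

Lemma sum_indicator : \sum_(s : idx S J) indicator V lambda F s x = 1.
Proof.
pose t : idx S J := [ffun i => s0 (val i)].
under eq_bigr do rewrite indicatorE.
(* Only the restriction t of s0 to S contributes. *)
rewrite (bigD1 t) //= big1 => [|s st].
  by rewrite addr0; case: forallP => //; case=> i; rewrite ffunE.
case: forallP => // /= st'; case/eqP: st; apply/ffunP => i.
by rewrite ffunE; apply/eqP/st'.
Qed.

End ProductIndicator.

Theorem proposition11 (R : realType)
  (N ny m : nat) (d : 'I_N -> nat)
  (J p : 'I_N -> nat)
  (P : forall i, set 'cV[R]_(d i))
  (F : forall i, 'I_(J i) -> set 'cV[R]_(d i))
  (K : set 'cV[R]_m)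
  (B : 'M[R]_(m, \sum_i d i)) (D : 'M[R]_(m, ny)) (c : 'cV[R]_m)
  (V : forall i, 'I_(p i) -> 'cV[R]_(d i))
  (lambda : forall i, 'I_(p i) -> 'cV[R]_(d i) -> R)
  (tau : forall i, 'I_(J i) -> R)
  (ppi : forall i, 'I_(J i) -> 'cV[R]_(d i))
  (k : nat)
  (hP : forall i, polytope (P i))
  (hF : forall i j, face (P i) (F i j))
  (hFdisj : forall i, trivIset setT (F i))
  (hK : convex_cone K)
  (hV : forall i, vertices_of (P i) (V i))
  (hlambda : forall i, barycentric (P i) (V i) (lambda i))
  (htau : forall i j, supports (P i) (F i j) (tau i j) (ppi i j))
  (hFvert : forall i (j j' : 'I_(J i)), j != j' ->
     forall v, ~ (vertex (F i j) v /\ vertex (F i j') v)) :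
  relaxation (FD F K B D c)
    (fun z => FDR P K B D c tau ppi k
                  (fun S s => indicator V lambda F s z.1) z)
  /\
  forall S : {set 'I_N}, #|S| = k ->
  forall (s : idx S J) (x : 'cV[R]_(\sum_i d i)), in_faces F x ->
    indicator V lambda F s x *: col_mx (1%:M : 'M[R]_1) x
      = \sum_(r : idx S p | vertices_in V F s r)
          coord_prod lambda r x
            *: col_mx (1%:M : 'M[R]_1) (\mxcol_i chi V i r x)
    /\
    forall r : idx S p,
      indicator V lambda F s x * coord_prod lambda r x
        = if vertices_in V F s r then coord_prod lambda r x else 0.
Proof.
have PV i q : P i (V i q).
  have [_ hv] := hV i; have /(_ (ex_intro _ q erefl)) := (hv (V i q)).2.
  by move=> /face_sub; apply.
have pick x : in_faces F x -> exists s0 : forall i, 'I_(J i),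
    forall i, F i (s0 i) (submxcol x i).
  move=> Fx; have Fx' i : exists j, F i j (submxcol x i).
    by have [j _ Fj] := Fx i; exists j.
  by exists (fun i => projT1 (cid (Fx' i))) => i; case: (cid _).
split.
  move=> [x y] [/= Kz /pick[s0 Fx]] S _.
  have Px i : P i (submxcol x i) by apply: face_sub (Fx i).
  have ge0 s : 0 <= indicator V lambda F s x.
    by rewrite (indicatorE hlambda PV hF hFdisj Fx) ler0n.
  split=> //.
  - move=> s; rewrite /le_cone sub0r -scalerN; apply: hK.2 => //.
    by rewrite -addrA opprD opprK.
  - by rewrite -scaler_suml (sum_indicator hlambda PV hF hFdisj Fx) scale1r.
  - by move=> s i; exists (submxcol x i).
  move=> s i; rewrite (indicatorE hlambda PV hF hFdisj Fx).
  case: forallP => [/(_ i)/eqP ->|_]; last by rewrite mul0r.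
  rewrite mul1r; have := Fx (val i).
  by rewrite (htau (val i) (s0 (val i))).2 => -[].
move=> S _ s x /pick[s0 Fx].
have Px i : P i (submxcol x i) by apply: face_sub (Fx i).
have etaE := indicator_coord_prod hlambda PV hF hFdisj Fx s.
(* Multiplying the r-th term by the indicator keeps it or kills it. *)
split=> //; rewrite -(sum_coord_prod_chi hlambda (S := S) Px).
rewrite scaler_sumr [in RHS]big_mkcond; apply: eq_bigr => r _.
by rewrite scalerA etaE; case: ifP; rewrite ?scale0r.
Qed.
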